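(* Let $A \in \mathbb{R}^{n \times n}$ be a skew-symmetric matrix, i.e. $A^T = -A$. Then $A$ can be factored as $$A = Q M Q^T,$$ where $Q \in \mathbb{R}^{n\times n}$ is an orthogonal matrix and $M \in \mathbb{R}^{n \times n}$ is a (lower) antitriangular matrix.
   Context: A matrix $M = (m_{ij}) \in \mathbb{R}^{n \times n}$ (indices $1 \le i,j \le n$) is called (lower) antitriangular if all its entries strictly above the main antidiagonal vanish, i.e. $m_{ij} = 0$ whenever $i + j \le n$. (The main antidiagonal consists of the entries with $i+j = n+1$; entries on or below it, and in particular the antidiagonal entries themselves, may be arbitrary, including zero.) *)

(* Defs.v *)
From mathcomp Require Import all_boot all_order all_algebra.
From mathcomp Require Import reals.

Set Implicit Arguments.
Unset Strict Implicit.
Unset Printing Implicit Defensive.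

Import GRing.Theory.
Local Open Scope ring_scope.

Definition skew_symmetric_mx (R : realType) (n : nat) (A : 'M[R]_n) : Prop :=
  A^T = - A.

Definition orthogonal_mx (R : realType) (n : nat) (Q : 'M[R]_n) : Prop :=
  Q^T *m Q = 1%:M.

(* The 0-based indices i, j : 'I_n are the 1-based indices i.+1, j.+1, so the
   entries strictly above the main antidiagonal are those with
   i.+1 + j.+1 <= n. *)
Definition antitriangular_mx (R : realType) (n : nat) (M : 'M[R]_n) : Prop :=
  forall i j : 'I_n, (i.+1 + j.+1 <= n)%N -> M i j = 0.

(* Main.v *)
(* Any unit vector may serve as the first column q_1 of Q.  By skew-symmetry
   A q_1 is orthogonal to q_1, so a unit vector q_n orthogonal to q_1 can be
   chosen with A q_1 in its span; this makes the first row and column of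
   Q^T A Q vanish except at the antidiagonal.  Taking q_1 = e_1, a Householder
   reflection of the other coordinates provides q_n, and the remaining central
   block of size n - 2 is again skew-symmetric, so induction applies. *)
Require Import Defs.
From mathcomp Require Import all_boot all_order all_algebra.
From mathcomp Require Import reals ring lra zify.

Local Open Scope ring_scope.

Import Order.TTheory GRing.Theory Num.Theory.

Lemma dotmx_ge0 (R : realType) (m : nat) (u : 'cV[R]_m) : 0 <= (u^T *m u) 0 0.
Proof. by rewrite mxE sumr_ge0 // => i _; rewrite mxE -expr2 sqr_ge0. Qed.

Lemma dotmx_eq0 (R : realType) (m : nat) (u : 'cV[R]_m) :
  (u^T *m u) 0 0 = 0 -> u = 0.
Proof.
rewrite mxE => /eqP; rewrite psumr_eq0 => [/allP u0|i _]; last first.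
  by rewrite mxE -expr2 sqr_ge0.
apply/matrixP => i j; rewrite ord1 mxE.
by have := u0 i (mem_index_enum _); rewrite mxE mulf_eq0 orbb => /eqP.
Qed.

(** With [c] the norm of [a], the vectors [a] and [c *: e] have equal length, so the Householder
    reflection along their difference [u] exchanges them. If [u = 0], the identity serves. *)
Lemma orthogonal_mx_to_line (R : realType) (m : nat) (a e : 'cV[R]_m) :
  e^T *m e = 1%:M ->
  exists (H : 'M[R]_m) (c : R), orthogonal_mx H /\ H *m a = c *: e.
Proof.
move=> ee; pose c := Num.sqrt ((a^T *m a) 0 0); pose u := a - c *: e.
have [u0|u0] := eqVneq u 0.
  exists 1%:M, c; split; first by rewrite /orthogonal_mx trmx1 mulmx1.
  by rewrite mul1mx; apply/eqP; rewrite -subr_eq0 -/u u0.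
pose s := (u^T *m u) 0 0.
have s0 : s != 0 by apply: contra_neq u0 => /dotmx_eq0.
have uu : u^T *m u = s%:M by rewrite [LHS]mx11_scalar.
have aa : a^T *m a = (c ^+ 2)%:M.
  by rewrite [LHS]mx11_scalar /c sqr_sqrtr // dotmx_ge0.
have ae : a^T *m e = e^T *m a.
  by rewrite [LHS]mx11_scalar -tr_scalar_mx -mx11_scalar trmx_mul trmxK.
(* Equal lengths give [s = 2 (c^2 - c e^T a) = 2 u^T a]; hence the reflection subtracts exactly [u]
   from [a]. *)
have ua : u^T *m a = (s / 2)%:M.
  have sE : s%:M = u^T *m a *+ 2.
    have uT : u^T = a^T - c *: e^T by rewrite /u linearB linearZ.
    rewrite -uu uT /u mulmxBr !mulmxBl -!scalemxAl -!scalemxAr.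
    by rewrite ee aa ae scalerA -expr2 scalemx1 opprB mulr2n.
  apply: (@scalerI _ _ 2); first by rewrite pnatr_eq0.
  by rewrite scaler_nat -sE scale_scalar_mx mulrC divfK ?pnatr_eq0.
pose H := 1%:M - (2 / s) *: (u *m u^T).
have HT : H^T = H by rewrite /H linearB linearZ /= trmx1 trmx_mul trmxK.
exists H, c; split.
  rewrite /orthogonal_mx HT /H.
  rewrite mulmxBl !mulmxBr !mul1mx mulmx1 -scalemxAl -scalemxAr.
  rewrite mulmxA -[u *m u^T *m u]mulmxA uu mul_mx_scalar -scalemxAl !scalerA.
  have -> : 2 / s * (2 / s * s) = 2 / s + 2 / s by field.
  by rewrite scalerDl opprB addrK subrK.
rewrite mulmxBl mul1mx -scalemxAl -mulmxA ua mul_mx_scalar scalerA.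
have -> : 2 / s * (s / 2) = 1 by field.
by rewrite scale1r /u subKr.
Qed.

Lemma orthogonal_mxM (R : realType) (m : nat) (P Q : 'M[R]_m) :
  orthogonal_mx P -> orthogonal_mx Q -> orthogonal_mx (P *m Q).
Proof.
rewrite /orthogonal_mx => hP hQ.
by rewrite trmx_mul mulmxA -[_ *m P^T *m P]mulmxA hP mulmx1.
Qed.

Lemma orthogonal_mxT (R : realType) (m : nat) (P : 'M[R]_m) :
  orthogonal_mx P -> orthogonal_mx P^T.
Proof. by move=> hP; rewrite /orthogonal_mx trmxK; apply: mulmx1C. Qed.

Lemma orthogonal_block_mx (R : realType) (m p : nat) (P : 'M[R]_m)
    (Q : 'M[R]_p) :
  orthogonal_mx P -> orthogonal_mx Q -> orthogonal_mx (block_mx P 0 0 Q).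
Proof.
rewrite /orthogonal_mx => hP hQ; rewrite tr_block_mx !trmx0 mulmx_block.
by rewrite !mulmx0 !mul0mx !addr0 add0r hP hQ -scalar_mx_block.
Qed.

Lemma skew_symmetric_mx_conj (R : realType) (m p : nat) (A : 'M[R]_m)
    (P : 'M[R]_(p, m)) :
  skew_symmetric_mx A -> skew_symmetric_mx (P *m A *m P^T).
Proof.
by rewrite /skew_symmetric_mx => hA; rewrite !trmx_mul trmxK hA mulNmx mulmxN mulmxA.
Qed.

Lemma skew_symmetric_block_mx (R : realType) (m p : nat) (A : 'M[R]_m) B C
    (D : 'M[R]_p) :
  skew_symmetric_mx (block_mx A B C D) ->
  [/\ skew_symmetric_mx A, B = - C^T & skew_symmetric_mx D].
Proof.
rewrite /skew_symmetric_mx tr_block_mx opp_block_mx => /eq_block_mx[-> hC hB ->].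
by split=> //; rewrite hC opprK.
Qed.

Lemma skew_symmetric_mx11 (R : realType) (A : 'M[R]_1) :
  skew_symmetric_mx A -> A = 0.
Proof.
move=> /matrixP /(_ 0 0); rewrite !mxE => h.
by apply/matrixP => i j; rewrite !ord1 mxE; lra.
Qed.

(** A border of width one on each side raises both the size and the index sum of each entry of [M]
    by two. The corners [x] and [y] fall on the antidiagonal, and [z], [t], [w] below it. *)
Lemma antitriangular_bordered_mx (R : realType) (n : nat) (M : 'M[R]_n)
    (x y w : 'M[R]_1) (z : 'cV[R]_n) (t : 'rV[R]_n) :
  antitriangular_mx M ->
  antitriangular_mx
    (block_mx (0 : 'M_1) (row_mx 0 x) (col_mx 0 y) (block_mx M z t w)).
Proof.
move=> hM i j; case: (split_ordP i) => i' -> {i}; case: (split_ordP j) => j' -> {j}.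
- by rewrite block_mxEul mxE.
- rewrite block_mxEur; case: (split_ordP j') => k -> /=; rewrite !ord1 /=.
    by rewrite row_mxEl mxE.
  lia.
- rewrite block_mxEdl; case: (split_ordP i') => k -> /=; rewrite !ord1 /=.
    by rewrite col_mxEu mxE.
  lia.
rewrite block_mxEdr.
case: (split_ordP i') => k ->; case: (split_ordP j') => l -> /= h.
- by rewrite block_mxEul; apply: hM; lia.
all: by have := ltn_ord k; have := ltn_ord l; lia.
Qed.

Lemma skew_antitriangular_step (R : realType) (n : nat) :
  (forall A : 'M[R]_n, skew_symmetric_mx A ->
     exists Q : 'M[R]_n, orthogonal_mx Q /\ antitriangular_mx (Q^T *m A *m Q)) ->
  forall A : 'M[R]_(1 + (n + 1)), skew_symmetric_mx A ->
     exists Q : 'M[R]_(1 + (n + 1)),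
       orthogonal_mx Q /\ antitriangular_mx (Q^T *m A *m Q).
Proof.
move=> IH A; rewrite -[A]submxK.
move: (ulsubmx A) (ursubmx A) (dlsubmx A) (drsubmx A) => a r b D {A}.
move=> /skew_symmetric_block_mx[/skew_symmetric_mx11-> -> hD].
(* The target is the last basis vector, so that the only nonzero entry left in the first column is
   on the antidiagonal. *)
pose e : 'cV[R]_(n + 1) := col_mx 0 1%:M.
have ee : e^T *m e = 1%:M.
  by rewrite tr_col_mx mul_row_col mulmx0 add0r trmx1 mulmx1.
have [H [c [hH Hb]]] := orthogonal_mx_to_line R _ b e ee.
have := skew_symmetric_mx_conj _ _ _ _ H hD.
(* Only the leading block of size [n] goes to the induction; the last row and column of
   [H *m D *m H^T] end up in the unconstrained part. *)
rewrite -[H *m D *m H^T]submxK => /skew_symmetric_block_mx[/IH[Q [hQ hM]] _ _].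
pose K : 'M[R]_(n + 1) := block_mx Q 0 0 1%:M.
have h1 m : orthogonal_mx (1%:M : 'M[R]_m) by rewrite /orthogonal_mx trmx1 mulmx1.
exists (block_mx 1%:M 0 0 (H^T *m K)); split.
  apply: orthogonal_block_mx; first exact: h1.
  apply: orthogonal_mxM; first exact: orthogonal_mxT.
  by apply: orthogonal_block_mx; last exact: h1.
(* [K^T] fixes [e], so applying [Q] to the central block does not disturb [H *m b = c *: e]. *)
have KHb : (H^T *m K)^T *m b = col_mx 0 c%:M.
  rewrite trmx_mul trmxK -mulmxA Hb -scalemxAr tr_block_mx mul_block_col.
  by rewrite !trmx0 !mulmx0 mul0mx trmx1 mulmx1 !add0r scale_col_mx scaler0 scalemx1.
have bHK : - b^T *m (H^T *m K) = row_mx 0 (- c%:M).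
  rewrite mulNmx -[b^T *m _]trmxK trmx_mul trmxK KHb tr_col_mx opp_row_mx.
  by rewrite trmx0 tr_scalar_mx oppr0.
rewrite tr_block_mx !trmx0 trmx1 !mulmx_block.
rewrite !(mulmx0, mul0mx, mul1mx, mulmx1, add0r, addr0) KHb bHK.
(* Regroup the lower right block as [K^T *m (H *m D *m H^T) *m K], whose leading block is the one
   treated by [hM]. *)
rewrite trmx_mul trmxK -2!mulmxA [D *m _]mulmxA [H *m _]mulmxA [H *m (D *m _)]mulmxA.
rewrite mulmxA -[H *m D *m H^T]submxK tr_block_mx !mulmx_block.
rewrite !(mulmx0, mul0mx, addr0, trmx0).
exact: antitriangular_bordered_mx.
Qed.

Lemma skew_antitriangular (R : realType) (n : nat) (A : 'M[R]_n) :
  skew_symmetric_mx A ->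
  exists Q : 'M[R]_n, orthogonal_mx Q /\ antitriangular_mx (Q^T *m A *m Q).
Proof.
(* The size drops by two, hence strong induction with base cases 0 and 1, where no entry lies
   strictly above the antidiagonal. *)
have [m] := ubnP n; elim: m n A => // m IHm [|[|n]] A.
- by move=> _ _; exists 1%:M; split=> [|[]//]; rewrite /orthogonal_mx trmx1 mulmx1.
- by move=> _ _; exists 1%:M; split=> [|i j]; [rewrite /orthogonal_mx trmx1 mulmx1|lia].
move=> ltnm; move: A; have -> : n.+2 = (1 + (n + 1))%N by lia.
by apply: skew_antitriangular_step => A; apply: IHm; lia.
Qed.

Theorem theorem2p1 (R : realType) (n : nat) (A : 'M[R]_n)
    (hA : skew_symmetric_mx A) :
  exists Q M : 'M[R]_n,
    [/\ orthogonal_mx Q, antitriangular_mx M & A = Q *m M *m Q^T].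
Proof.
have [Q [hQ hM]] := skew_antitriangular R n A hA.
have QQT : Q *m Q^T = 1%:M by apply: mulmx1C.
exists Q, (Q^T *m A *m Q); split=> //.
by rewrite !mulmxA QQT mul1mx -mulmxA QQT mulmx1.
Qed.
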